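(* Let $A$ be a finite dimensional Hopf algebra over a field $k$, let $R=\sum R^1\otimes R^2$ be the $R$-matrix of its Drinfel'd double $D(A)$, let $W=\sum_i(1\otimes e^i)\otimes(e_i\otimes\varepsilon)\in\mathcal{H}(A)\otimes\mathcal{H}(A)$ be the canonical element of the Heisenberg double $\mathcal{H}(A)$, where $\{e_i\}$ is a basis of $A$ and $\{e^i\}$ its dual basis in $A^*$, and let $Q:D(A)^*\to D(A)$, $Q(P)=\sum P(R^2r^1)R^1r^2$ (with $R=\sum r^1\otimes r^2$ a second copy of $R$) be the linear isomorphism expressing the factorizability of $D(A)$. Then $$W=(Q^{-1}\otimes Q^{-1})(R_{21}),$$ where $D(A)^*$ and $\mathcal{H}(A)$ are identified as linear spaces and $R_{21}=\sum R^2\otimes R^1$.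
   Context: $S$ is the antipode of $A$, $\Delta(a)=\sum a_1\otimes a_2$; on $A^*$ the product is convolution and $p(ab)=\sum p_1(a)p_2(b)$. Regular actions of $A$ on $A^*$: $(a\rightharpoonup p)(b)=p(ba)$, $(p\leftharpoonup a)(b)=p(ab)$. $D(A)$ is the vector space $A^*\otimes A$ with $\Delta(p\otimes a)=\sum(p_2\otimes a_1)\otimes(p_1\otimes a_2)$, product $(p\otimes a)(p'\otimes a')=\sum p(a_1\rightharpoonup p'\leftharpoonup S^{-1}(a_3))\otimes a_2a'$, and $R$-matrix $R=\sum_i(\varepsilon\otimes e_i)\otimes(e^i\otimes 1)$. $\mathcal{H}(A)$ is the vector space $A\otimes A^*$ (with product $(a\otimes p)(a'\otimes p')=\sum a(p_1\rightharpoonup a')\otimes p_2p'$, $p\rightharpoonup a=\sum p(a_2)a_1$), identified with $D(A)^*$ as a linear space via $(a\otimes f)(p\otimes x)=p(a)f(x)$. *)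

(* Defs.v *)
From HB Require Import structures.
From mathcomp Require Import all_boot all_algebra falgebra.

Set Implicit Arguments.
Unset Strict Implicit.
Unset Printing Implicit Defensive.

Import GRing.Theory.
Local Open Scope ring_scope.

Definition dual (k : fieldType) (U : vectType k) : Type := 'Hom(U, k^o).
HB.instance Definition _ (k : fieldType) (U : vectType k) :=
  Vector.copy (dual U) 'Hom(U, k^o).
Identity Coercion hom_of_dual : dual >-> hom.

(* U (x) V is modelled by Hom(U^*, V); u \ox v is the map p |-> p(u) v.
   Lemmas tlift_pure and tlift_id give the universal property. *)
Definition tens (k : fieldType) (U V : vectType k) : Type := 'Hom(dual U, V).
HB.instance Definition _ (k : fieldType) (U V : vectType k) :=
  Vector.copy (tens U V) 'Hom(dual U, V).
Identity Coercion hom_of_tens : tens >-> hom.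

Definition dual_basis (k : fieldType) (U : vectType k) (n : nat)
  (e : n.-tuple U) (i : 'I_n) : dual U := linfun (coord e i : U -> k^o).

Section Tensor.
Variable k : fieldType.
Implicit Types U V W : vectType k.

Definition pure U V (u : U) (v : V) : tens U V :=
  linfun (fun p : dual U => p u *: v).

(* The linear map U (x) V -> W induced by a bilinear map b. *)
Definition tlift U V W (t : tens U V) (b : U -> V -> W) : W :=
  \sum_(i < \dim {:U})
    b (vbasis {:U})`_i (t (dual_basis (vbasis {:U}) i)).

End Tensor.

Notation "u \ox v" := (pure u v) (at level 40, left associativity) : ring_scope.
(* Sweedler-style sums: if t = \sum u (x) v, this is \sum E(u, v), for E
   bilinear in (u, v). *)
Notation "\ten_ ( u , v <- t ) E" := (tlift t (fun u v => E))
  (at level 41, E at level 41, u name, v name, t at level 200,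
   format "'[' \ten_ ( u ,  v  <-  t ) '/  '  E ']'") : ring_scope.

Section TensorTheory.
Variable k : fieldType.
Implicit Types U V W : vectType k.

Definition bilinear_map U V W (b : U -> V -> W) : Prop :=
  (forall v, linear (b^~ v)) /\ (forall u, linear (b u)).

Lemma linfun_linearE U V (f : U -> V) : linear f -> linfun f =1 f.
Proof.
move=> fL u; pose g : {linear U -> V} := HB.pack f (GRing.isLinear.Build _ _ _ _ f fL).
by rewrite (lfunE g).
Qed.

Lemma pureE U V (u : U) (v : V) (p : dual U) : (u \ox v) p = p u *: v.
Proof.
rewrite /pure linfun_linearE // => a q r.
by rewrite add_lfunE scale_lfunE scalerDl -scalerA.
Qed.

Lemma pure_bilinear U V : bilinear_map (@pure k U V).
Proof.
split=> [v a u u'|u a v v']; apply/lfunP=> p;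
  rewrite add_lfunE scale_lfunE !pureE.
  by rewrite linearP scalerDl -scalerA.
by rewrite scalerDr !scalerA mulrC.
Qed.

Lemma dual_basisE U n (e : n.-tuple U) i u : dual_basis e i u = coord e i u.
Proof. by rewrite /dual_basis lfunE. Qed.

Lemma tlift_linear U V W (b : U -> V -> W) :
  bilinear_map b -> linear (fun t : tens U V => tlift t b).
Proof.
move=> [_ br] a s t; rewrite /tlift scaler_sumr -big_split /=.
by apply: eq_bigr => i _; rewrite add_lfunE scale_lfunE br.
Qed.


Lemma linear_bigsum U W (f : U -> W) (I : finType) (x : I -> U) :
  linear f -> f (\sum_i x i) = \sum_i f (x i).
Proof.
move=> fL; pose g : {linear U -> W} := HB.pack f (GRing.isLinear.Build _ _ _ _ f fL).
exact: (linear_sum g).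
Qed.

Lemma linear_sumZ U W (f : U -> W) (I : finType) (c : I -> k) (x : I -> U) :
  linear f -> f (\sum_i c i *: x i) = \sum_i c i *: f (x i).
Proof.
move=> fL; pose g : {linear U -> W} := HB.pack f (GRing.isLinear.Build _ _ _ _ f fL).
rewrite -[f _]/(g _) linear_sum; by apply: eq_bigr => i _; rewrite linearZ.
Qed.

Lemma linear_scale U W (f : U -> W) c u : linear f -> f (c *: u) = c *: f u.
Proof. by move=> fL; have := linear_sumZ (I := 'I_1) (fun=> c) (fun=> u) fL; rewrite !big_ord1. Qed.

Lemma tlift_pure U V W (b : U -> V -> W) u v :
  bilinear_map b -> \ten_(x, y <- u \ox v) b x y = b u v.
Proof.
move=> [bl br]; rewrite [in RHS](coord_vbasis (memvf u)).
rewrite (linear_sumZ _ _ (bl v)); apply: eq_bigr => i _.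
by rewrite pureE dual_basisE linear_scale.
Qed.

Lemma tlift_id U V (t : tens U V) : \ten_(u, v <- t) u \ox v = t.
Proof.
apply/lfunP=> p; rewrite /tlift sum_lfunE.
have -> : p = \sum_(i < \dim {:U}) p (vbasis {:U})`_i *: dual_basis (vbasis {:U}) i.
  apply/lfunP=> u; rewrite sum_lfunE [in LHS](coord_vbasis (memvf u)) linear_sum.
  by apply: eq_bigr => i _; rewrite linearZ scale_lfunE dual_basisE /GRing.scale /= mulrC.
rewrite linear_sum; apply: eq_bigr => i _; rewrite linearZ pureE; congr (_ *: _).
rewrite sum_lfunE (bigD1 i) //= big1 => [|j ji]; rewrite scale_lfunE dual_basisE
  coord_free ?(basis_free (vbasisP _)) //.
  by rewrite eqxx addr0 /GRing.scale /= mulr1.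
by rewrite eq_sym (negPf ji) scaler0.
Qed.

Lemma tlift_linear_param (X : vectType k) U V W (t : tens U V) (b : X -> U -> V -> W) :
  (forall u v, linear (fun x => b x u v)) -> linear (fun x => tlift t (b x)).
Proof.
move=> bL c x y; rewrite /tlift scaler_sumr -big_split /=.
by apply: eq_bigr => i _; rewrite bL.
Qed.

Lemma lfun_ext_pure U V W (f g : 'Hom(tens U V, W)) :
  (forall u v, f (u \ox v) = g (u \ox v)) -> f = g.
Proof.
move=> fg; apply/lfunP=> t; rewrite -(tlift_id t) !linear_sum.
by apply: eq_bigr => i _; apply: fg.
Qed.
End TensorTheory.

Definition tmap (k : fieldType) (U V U' V' : vectType k)
    (f : U -> U') (g : V -> V') (t : tens U V) : tens U' V' :=
  \ten_(u, v <- t) f u \ox g v.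

Definition tflip (k : fieldType) (U V : vectType k) (t : tens U V) : tens V U :=
  \ten_(u, v <- t) v \ox u.

Definition tens_mul (k : fieldType) (A B : falgType k) (s t : tens A B) :
    tens A B :=
  \ten_(a, b <- s) \ten_(a', b' <- t) (a * a') \ox (b * b').

HB.mixin Record isHopf (k : fieldType) (A : Type) of Falgebra k A := {
  comul : 'Hom(A, tens A A);
  counit : dual A;
  antipode : 'End(A);
  comulA : forall a : A,
    \ten_(a1, a2 <- comul a) \ten_(b1, b2 <- comul a1) b1 \ox (b2 \ox a2) =
    \ten_(a1, a2 <- comul a) a1 \ox comul a2;
  counitl : forall a : A, \ten_(a1, a2 <- comul a) counit a1 *: a2 = a;
  counitr : forall a : A, \ten_(a1, a2 <- comul a) counit a2 *: a1 = a;
  comul1 : comul 1 = 1 \ox 1;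
  comulM : forall a b : A, comul (a * b) = tens_mul (comul a) (comul b);
  counit1 : counit 1 = 1;
  counitM : forall a b : A, counit (a * b) = counit a * counit b;
  antipodel : forall a : A,
    \ten_(a1, a2 <- comul a) antipode a1 * a2 = (counit a)%:A;
  antipoder : forall a : A,
    \ten_(a1, a2 <- comul a) a1 * antipode a2 = (counit a)%:A
}.

#[short(type="hopfAlgType")]
HB.structure Definition HopfAlg (k : fieldType) :=
  { A of isHopf k A & Falgebra k A }.

Section Doubles.
Variables (k : fieldType) (A : hopfAlgType k).
Implicit Types (a b : A) (p q : dual A).

Local Notation Delta := (@comul k A).
Local Notation eps := (@counit k A).

(* p q, p <- a, a -> p in A^* and p -> a in A are conv p q, ract p a, lact a p
   and hit p a. *)
Definition conv p q : dual A :=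
  linfun (fun a => \ten_(a1, a2 <- Delta a) (p a1 * q a2 : k^o)).

Definition lact a p : dual A := linfun (fun b => p (b * a)).
Definition ract p a : dual A := linfun (fun b => p (a * b)).

(* The coproduct dual to the product of A: p(ab) = \sum p_1(a) p_2(b). *)
Definition dual_comul p : tens (dual A) (dual A) :=
  let e := vbasis {:A} in
  \sum_(i < \dim {:A}) \sum_(j < \dim {:A}) p (e`_i * e`_j) *: (dual_basis e i \ox dual_basis e j).

Definition hit p a : A := \ten_(a1, a2 <- Delta a) p a2 *: a1.

Definition drinfeld_double : Type := tens (dual A) A.
HB.instance Definition _ := Vector.copy drinfeld_double (tens (dual A) A).

(* The inverse of the antipode is its inverse as a linear map; it exists
   because A is finite dimensional. *)
Definition drinfeld_mul (x y : drinfeld_double) : drinfeld_double :=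
  \ten_(p, a <- x) \ten_(p', a' <- y)
    \ten_(a1, a23 <- Delta a) \ten_(a2, a3 <- Delta a23)
      conv p (ract (lact a1 p') ((@antipode k A)^-1%VF a3)) \ox (a2 * a').

Definition drinfeld_comul (x : drinfeld_double) : tens drinfeld_double drinfeld_double :=
  \ten_(p, a <- x) \ten_(p1, p2 <- dual_comul p) \ten_(a1, a2 <- Delta a)
    ((p2 \ox a1 : drinfeld_double) \ox (p1 \ox a2 : drinfeld_double)).

Definition heisenberg : Type := tens A (dual A).
HB.instance Definition _ := Vector.copy heisenberg (tens A (dual A)).

Definition heisenberg_mul (x y : heisenberg) : heisenberg :=
  \ten_(a, p <- x) \ten_(a', p' <- y) \ten_(p1, p2 <- dual_comul p)
    (a * hit p1 a') \ox conv p2 p'.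

(* The linear identification of H(A) with D(A)^*; see heisenberg_dualE and
   heisenberg_dual_bij. *)
Definition heisenberg_dual : 'Hom(heisenberg, dual drinfeld_double) :=
  linfun (fun h : heisenberg => \ten_(a, f <- h)
    (linfun (fun y : drinfeld_double => \ten_(p, x <- y) (p a * f x : k^o)) : dual drinfeld_double)).

Lemma lactE a p b : lact a p b = p (b * a).
Proof. by rewrite linfun_linearE // => c x y; rewrite mulrDl -scalerAl linearP. Qed.

Lemma ractE p a b : ract p a b = p (a * b).
Proof. by rewrite linfun_linearE // => c x y; rewrite mulrDr -scalerAr linearP. Qed.

Lemma mul_dual_bilinear p q : bilinear_map (fun a b => (p a * q b : k^o)).
Proof.
split=> [b c x y|a c x y]; rewrite linearP.
  by rewrite mulrDl -mulrA.
by rewrite mulrDr /GRing.scale /= mulrCA.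
Qed.

Lemma convE p q a : conv p q a = \ten_(a1, a2 <- Delta a) (p a1 * q a2 : k^o).
Proof.
rewrite linfun_linearE // => c x y.
by rewrite linearP tlift_linear //; apply: mul_dual_bilinear.
Qed.

Lemma dual_comulE p a b :
  \ten_(p1, p2 <- dual_comul p) (p1 a * p2 b : k^o) = p (a * b).
Proof.
have evL : bilinear_map (fun p1 p2 : dual A => (p1 a * p2 b : k^o)).
  by split=> [q c x y|q c x y]; rewrite add_lfunE scale_lfunE /GRing.scale /=;
     [rewrite mulrDl mulrA | rewrite mulrDr mulrCA].
have sumE (I : finType) (F : I -> tens (dual A) (dual A)) :
    tlift (\sum_i F i) (fun p1 p2 : dual A => (p1 a * p2 b : k^o)) =
    \sum_i tlift (F i) (fun p1 p2 : dual A => (p1 a * p2 b : k^o)).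
  exact: linear_bigsum (tlift_linear evL).
rewrite sumE [in RHS](coord_vbasis (memvf a)) mulr_suml linear_sum.
apply: eq_bigr => i _; rewrite sumE -scalerAl linearZ.
rewrite [in RHS](coord_vbasis (memvf b)) mulr_sumr linear_sum.
apply: etrans (esym (mulr_sumr _ _ _ _)).
apply: eq_bigr => j _; rewrite (linear_scale _ _ (tlift_linear evL)) tlift_pure //.
have pZ c x : p (c *: x) = c * p x by rewrite linearZ.
rewrite -scalerAr /= pZ !dual_basisE /GRing.scale /=.
by rewrite [LHS]mulrC -mulrA.
Qed.

Lemma heisenberg_dual_evalE (h : heisenberg) (y : drinfeld_double) :
  heisenberg_dual h y = \ten_(a, f <- h) \ten_(p, x <- y) (p a * f x : k^o).
Proof.
have bL (a : A) (f : dual A) : bilinear_map (fun (p : dual A) (x : A) => (p a * f x : k^o)).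
  split=> [x c p q|p c x y0]; rewrite ?add_lfunE ?scale_lfunE ?linearP.
    by rewrite mulrDl -mulrA.
  by rewrite mulrDr /GRing.scale /= mulrCA.
have inE (a : A) (f : dual A) (z : drinfeld_double) : (linfun (fun z : drinfeld_double =>
    \ten_(p, x <- z) (p a * f x : k^o)) : dual drinfeld_double) z =
    \ten_(p, x <- z) (p a * f x : k^o).
  by rewrite linfun_linearE //; apply: tlift_linear.
rewrite linfun_linearE.
  by rewrite /tlift sum_lfunE; apply: eq_bigr => i _; rewrite inE.
apply: tlift_linear; split=> [f c a b|a c f g]; apply/lfunP=> z;
  rewrite add_lfunE scale_lfunE !inE /tlift scaler_sumr -big_split /=;
  apply: eq_bigr => i _; rewrite ?linearP ?add_lfunE ?scale_lfunE /GRing.scale /=.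
  by rewrite mulrDl mulrA.
by rewrite mulrDr mulrCA.
Qed.

Lemma heisenberg_dualE a f p x :
  heisenberg_dual (a \ox f : heisenberg) (p \ox x : drinfeld_double) = p a * f x.
Proof.
rewrite heisenberg_dual_evalE.
have bL (b : A) (g : dual A) :
    bilinear_map (fun (q : dual A) (y : A) => (q b * g y : k^o)).
  split=> [y c q r|q c y z]; rewrite ?add_lfunE ?scale_lfunE ?linearP.
    by rewrite mulrDl -mulrA.
  by rewrite mulrDr /GRing.scale /= mulrCA.
rewrite tlift_pure ?tlift_pure //.
split=> [g c b b'|b c g g']; rewrite /tlift scaler_sumr -big_split /=;
  apply: eq_bigr => i _; rewrite ?linearP ?add_lfunE ?scale_lfunE /GRing.scale /=.
  by rewrite mulrDl mulrA.
by rewrite mulrDr mulrCA.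
Qed.

Lemma heisenberg_dual_pure (h : heisenberg) (p : dual A) (x : A) :
  heisenberg_dual h (p \ox x : drinfeld_double) = (h p : dual A) x.
Proof.
rewrite -[h]tlift_id /tlift linear_sum !sum_lfunE; apply: eq_bigr => i _.
by rewrite heisenberg_dualE pureE scale_lfunE.
Qed.

Lemma heisenberg_dual_bij : bijective heisenberg_dual.
Proof.
pose G (P : dual drinfeld_double) (p : dual A) : dual A :=
  linfun (fun x : A => P (p \ox x : drinfeld_double)).
have [pl pr] := @pure_bilinear k (dual A) A.
have GE P p x : G P p x = P (p \ox x : drinfeld_double).
  by rewrite linfun_linearE // => c y z; rewrite pr linearP.
have GL P : linear (G P).
  by move=> c p q; apply/lfunP=> x; rewrite add_lfunE scale_lfunE !GE pl linearP.
exists (fun P => linfun (G P)) => [h|P].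
  apply/lfunP=> p; rewrite linfun_linearE //; apply/lfunP=> x.
  by rewrite GE heisenberg_dual_pure.
apply: lfun_ext_pure => p x.
by rewrite heisenberg_dual_pure linfun_linearE // GE.
Qed.

Section CanonicalElements.
Variables (n : nat) (e : n.-tuple A).

(* For a basis e of A, Rmatrix, Wcan and Qmap are R, W and Q. *)
Definition Rmatrix : tens drinfeld_double drinfeld_double :=
  \sum_(i < n) ((eps \ox e`_i : drinfeld_double) \ox (dual_basis e i \ox 1 : drinfeld_double)).

Definition Wcan : tens heisenberg heisenberg :=
  \sum_(i < n) ((1 \ox dual_basis e i : heisenberg) \ox (e`_i \ox eps : heisenberg)).

Definition Qmap : 'Hom(dual drinfeld_double, drinfeld_double) :=
  linfun (fun P : dual drinfeld_double =>
    \ten_(R1, R2 <- Rmatrix) \ten_(r1, r2 <- Rmatrix)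
      P (drinfeld_mul R2 r1) *: drinfeld_mul R1 r2).


Lemma QmapE P :
  Qmap P = \ten_(R1, R2 <- Rmatrix) \ten_(r1, r2 <- Rmatrix)
             P (drinfeld_mul R2 r1) *: drinfeld_mul R1 r2.
Proof.
rewrite linfun_linearE //; do 2!apply: tlift_linear_param => ? ?.
by move=> c x y; rewrite add_lfunE scale_lfunE scalerDl scalerA.
Qed.

End CanonicalElements.
End Doubles.

(* Main.v *)
Require Import Defs.
From mathcomp Require Import all_boot all_algebra falgebra.

Set Implicit Arguments.
Unset Strict Implicit.
Unset Printing Implicit Defensive.

Import GRing.Theory.
Local Open Scope ring_scope.

(** Why the theorem is true.  In D(A) one has (p (x) 1)(eps (x) a) = p (x) a, so
    that Q, on a pure tensor a (x) f of H(A) = D(A)^*, collapses to the product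
    taken in the other order:
<<
      Q(a (x) f) = (eps (x) a)(f (x) 1)
                 = \sum (a_1 -> f <- S^-1(a_3)) (x) a_2
>>
    ([Qmap_heisenberg]).  Hence Q(1 (x) e^i) = e^i (x) 1 and
    Q(e_i (x) eps) = eps (x) e_i, and applying Q to both legs of W gives R_21 term
    by term; what remains is that Q is invertible.

    Q is onto because every p (x) a can be rewritten with its factors in the
    opposite order, by the usual straightening
<<
      p (x) a = \sum (eps (x) a_2)((S^-1(a_1) -> p <- a_3) (x) 1)
>>
    ([drinfeld_mul_cross]), and it is one-to-one because D(A)^* and D(A) have
    the same dimension.

    The straightening uses the identity \sum a_2 S^-1(a_1) = eps(a) 1, hence
    that S is bijective on a finite dimensional Hopf algebra.  This can be seen
    without integrals.  A Fitting argument yields an even N > 0 such that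
    phi = S^N restricts to a bijection of its image; let e(a) be the element of
    that image with phi(e(a)) = phi(a).  Since phi is an algebra endomorphism so
    is e, and e o phi = phi.  A multiplicative map f is determined by f o S,
    because f o S is its convolution inverse ([antipode_epi]); so from
    e o S^N = S^N one descends to e o S^0 = S^0, that is e = id, and therefore S
    is injective ([lker_antipode]). *)

(** * Linearity of expressions and Sweedler sums *)

Section Linear.
Variable k : fieldType.
Implicit Types U V W X : vectType k.

Lemma lin_id U : linear (fun x : U => x). Proof. by []. Qed.

Lemma lin_lfun U V W (f : 'Hom(V, W)) (g : U -> V) :
  linear g -> linear (fun x => f (g x)).
Proof. by move=> gL c x y; rewrite gL linearP. Qed.


Lemma lin_scalel U W (f : U -> k) (w : W) :
  linear (f : U -> k^o) -> linear (fun x => f x *: w).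
Proof. by move=> fL c x y; rewrite fL scalerDl -scalerA. Qed.

Lemma lin_scaler U W (c : k) (f : U -> W) :
  linear f -> linear (fun x => c *: f x).
Proof. by move=> fL d x y; rewrite fL scalerDr !scalerA mulrC. Qed.

Lemma lin_mull U (B : falgType k) (f : U -> B) (b : B) :
  linear f -> linear (fun x => f x * b).
Proof. by move=> fL c x y; rewrite fL mulrDl -scalerAl. Qed.

Lemma lin_mulr U (B : falgType k) (f : U -> B) (b : B) :
  linear f -> linear (fun x => b * f x).
Proof. by move=> fL c x y; rewrite fL mulrDr -scalerAr. Qed.

Lemma lin_purel U V W (f : U -> V) (w : W) :
  linear f -> linear (fun x => f x \ox w).
Proof. by move=> fL c x y; rewrite fL (pure_bilinear V W).1. Qed.

Lemma lin_purer U V W (f : U -> V) (w : W) :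
  linear f -> linear (fun x => w \ox f x).
Proof. by move=> fL c x y; rewrite fL (pure_bilinear W V).2. Qed.

Lemma lin_tliftl X U V W (t : X -> tens U V) (b : U -> V -> W) :
  linear t -> bilinear_map b -> linear (fun x => tlift (t x) b).
Proof. by move=> tL bL c x y; rewrite tL (tlift_linear bL). Qed.

Lemma lin_tliftr X U V W (t : tens U V) (b : X -> U -> V -> W) :
  (forall u v, linear (fun x => b x u v)) -> linear (fun x => tlift t (b x)).
Proof. exact: tlift_linear_param. Qed.

Lemma lin_bill X U V W (b : U -> V -> W) (f : X -> U) (v : V) :
  bilinear_map b -> linear f -> linear (fun x => b (f x) v).
Proof. by move=> bL fL c x y; rewrite fL bL.1. Qed.

Lemma lin_bilr X U V W (b : U -> V -> W) (f : X -> V) (u : U) :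
  bilinear_map b -> linear f -> linear (fun x => b u (f x)).
Proof. by move=> bL fL c x y; rewrite fL bL.2. Qed.

Lemma eq_tlift U V W (t : tens U V) (b b' : U -> V -> W) :
  (forall u v, b u v = b' u v) -> tlift t b = tlift t b'.
Proof. by move=> bb; apply: eq_bigr => i _. Qed.

Lemma linear_tlift U V W X (f : W -> X) (t : tens U V) (b : U -> V -> W) :
  linear f -> f (tlift t b) = \ten_(u, v <- t) f (b u v).
Proof. by move=> fL; rewrite /tlift linear_bigsum. Qed.

Lemma scale_tlift U V W (c : k) (t : tens U V) (b : U -> V -> W) :
  c *: tlift t b = \ten_(u, v <- t) c *: b u v.
Proof. exact: scaler_sumr. Qed.

Lemma exchange_tlift U V U' V' W (s : tens U V) (t : tens U' V')
    (b : U -> V -> U' -> V' -> W) :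
  \ten_(u, v <- s) \ten_(u', v' <- t) b u v u' v' =
  \ten_(u', v' <- t) \ten_(u, v <- s) b u v u' v'.
Proof. exact: exchange_big. Qed.

Lemma tlift_sum U V W (I : finType) (t : I -> tens U V) (b : U -> V -> W) :
  bilinear_map b -> tlift (\sum_i t i) b = \sum_i tlift (t i) b.
Proof. by move=> bL; rewrite (linear_bigsum _ (tlift_linear bL)). Qed.

End Linear.

Section DualLinear.
Variables (k : fieldType) (A : hopfAlgType k).
Local Notation Delta := (@comul k A).

Lemma lin_lactl (U : vectType k) (f : U -> A) (p : dual A) :
  linear f -> linear (fun x => lact (f x) p).
Proof.
move=> fL c x y; apply/lfunP=> a; rewrite add_lfunE scale_lfunE !lactE.
by rewrite fL mulrDr -scalerAr linearP.
Qed.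

Lemma lin_lactr (U : vectType k) (a : A) (f : U -> dual A) :
  linear f -> linear (fun x => lact a (f x)).
Proof.
move=> fL c x y; apply/lfunP=> b.
by rewrite add_lfunE scale_lfunE !lactE fL add_lfunE scale_lfunE.
Qed.

Lemma lin_ractl (U : vectType k) (a : A) (f : U -> dual A) :
  linear f -> linear (fun x => ract (f x) a).
Proof.
move=> fL c x y; apply/lfunP=> b.
by rewrite add_lfunE scale_lfunE !ractE fL add_lfunE scale_lfunE.
Qed.

Lemma lin_ractr (U : vectType k) (f : U -> A) (p : dual A) :
  linear f -> linear (fun x => ract p (f x)).
Proof.
move=> fL c x y; apply/lfunP=> a; rewrite add_lfunE scale_lfunE !ractE.
by rewrite fL mulrDl -scalerAl linearP.
Qed.

Lemma lin_convl (U : vectType k) (f : U -> dual A) (q : dual A) :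
  linear f -> linear (fun x => conv (f x) q).
Proof.
move=> fL c x y; apply/lfunP=> a; rewrite add_lfunE scale_lfunE !convE.
rewrite /tlift scaler_sumr -big_split /=; apply: eq_bigr => i _.
by rewrite fL add_lfunE scale_lfunE mulrDl -scalerAl.
Qed.

Lemma lin_convr (U : vectType k) (f : U -> dual A) (q : dual A) :
  linear f -> linear (fun x => conv q (f x)).
Proof.
move=> fL c x y; apply/lfunP=> a; rewrite add_lfunE scale_lfunE !convE.
rewrite /tlift scaler_sumr -big_split /=; apply: eq_bigr => i _.
by rewrite fL add_lfunE scale_lfunE mulrDr -scalerAr.
Qed.
End DualLinear.

(** Every rule of the Sweedler calculus below asks for the linearity of some
    expression; [lin] decomposes it along its unique argument that depends on
    the bound variable, since a pattern such as [?v] cannot match a term in which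
    that variable occurs. *)
Ltac lin_step :=
  match goal with
  | |- bilinear_map _ => split
  | |- forall _, _ => intro; cbv beta
  | |- linear (fun_of_lfun _) => exact: linearP
  | |- linear (fun x => x) => apply: lin_id
  | |- linear (fun x => tlift (@?t x) ?b) => apply: (@lin_tliftl _ _ _ _ _ t b)
  | |- linear (fun x => tlift ?t (@?b x)) =>
      apply: (@lin_tliftr _ _ _ _ _ t b)
  | |- linear (fun x => pure (@?f x) ?v) => apply: (@lin_purel _ _ _ _ f v)
  | |- linear (fun x => pure ?v (@?f x)) => apply: (@lin_purer _ _ _ _ f v)
  | |- linear (fun x => conv (@?f x) ?v) => apply: (@lin_convl _ _ _ f v)
  | |- linear (fun x => conv ?v (@?f x)) => apply: (@lin_convr _ _ _ f v)
  | |- linear (fun x => lact (@?f x) ?v) => apply: (@lin_lactl _ _ _ f v)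
  | |- linear (fun x => lact ?v (@?f x)) => apply: (@lin_lactr _ _ _ v f)
  | |- linear (fun x => ract (@?f x) ?v) => apply: (@lin_ractl _ _ _ v f)
  | |- linear (fun x => ract ?v (@?f x)) => apply: (@lin_ractr _ _ _ f v)
  | |- linear (fun x => GRing.scale (@?f x) ?v) => apply: (@lin_scalel _ _ _ f v)
  | |- linear (fun x => GRing.scale _ (@?f x)) => apply: (@lin_scaler _ _ _ _ f)
  | |- linear (fun x => GRing.mul (@?f x) ?v) => apply: (@lin_mull _ _ _ f v)
  | |- linear (fun x => GRing.mul ?v (@?f x)) => apply: (@lin_mulr _ _ _ f v)
  | |- linear (fun x => fun_of_lfun ?f (@?g x)) => apply: (@lin_lfun _ _ _ _ f g)
  | H : bilinear_map ?m |- linear (fun x => ?m (@?f x) ?v) =>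
      apply: (@lin_bill _ _ _ _ _ m f v H)
  | H : bilinear_map ?m |- linear (fun x => ?m ?v (@?f x)) =>
      apply: (@lin_bilr _ _ _ _ _ m f v H)
  end; cbv beta.
Ltac lin := repeat lin_step.

(** * Iterates of an endomorphism *)

Section Fitting.
Variables (k : fieldType) (V : vectType k) (T : 'End(V)).

Definition lfun_iter n : 'End(V) := iter n (comp_lfun T) \1%VF.

Lemma lfun_iterE n x : lfun_iter n x = iter n T x.
Proof. by elim: n => [|n IH] /=; rewrite ?id_lfunE // comp_lfunE IH. Qed.

(** A bounded sequence cannot increase at every doubling of the index.  Starting
    at 2 makes the stationary index even and positive. *)
Lemma doubling_stationary (d : nat -> nat) b : (forall n, d n <= b)%N ->
  exists i, (d (2 ^ i.+2) <= d (2 ^ i.+1))%N.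
Proof.
move=> db; case: (boolP [exists i : 'I_b.+1, d (2 ^ i.+2) <= d (2 ^ i.+1)]%N).
  by case/existsP=> i di; exists i.
rewrite negb_exists => /forallP dN.
suff dge j : (j <= b.+1)%N -> (j <= d (2 ^ j.+1))%N.
  by have := leq_trans (dge b.+1 (leqnn _)) (db _); rewrite ltnn.
elim: j => // j IH jb; apply: leq_ltn_trans (IH (ltnW jb)) _.
by have := dN (Ordinal jb); rewrite -ltnNge.
Qed.

(** Fitting's lemma for a power phi of T: once the kernels of phi and phi^2 have
    the same dimension, phi is injective on its image, and phi and phi^2 have the
    same image, so that phi^2 has a section g over it. *)
Lemma fitting : exists i : nat, let phi := lfun_iter (2 ^ i.+1)%N in
  (forall x, phi (phi x) = 0 -> phi x = 0) /\
  (exists g : 'End(V), forall x, phi (phi (g x)) = phi x).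
Proof.
have [i di] := @doubling_stationary (fun n => \dim (lker (lfun_iter n)))
  (\dim {:V}) (fun n => dimvS (subvf _)).
exists i => /=; set phi := lfun_iter (2 ^ i.+1)%N in di *.
pose phi2 := (phi \o phi)%VF.
have phi2E : lfun_iter (2 ^ i.+2)%N = phi2.
  by apply/lfunP=> x; rewrite comp_lfunE !lfun_iterE -iterD addnn -mul2n -expnS.
have kerphi : lker phi2 = lker phi.
  apply/esym/eqP; rewrite eqEdim -{2}phi2E di andbT.
  by apply/subvP=> x; rewrite !memv_ker comp_lfunE => /eqP->; rewrite linear0.
split=> [x /eqP|].
  by rewrite -comp_lfunE -memv_ker kerphi memv_ker => /eqP.
have img : limg phi2 = limg phi.
  apply/eqP; rewrite eqEdim; apply/andP; split.
    by apply/subvP=> _ /memv_imgP[x _ ->]; rewrite comp_lfunE memv_img ?memvf.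
  rewrite -(leq_add2l (\dim (fullv :&: lker phi))) limg_ker_dim -{1}kerphi.
  by rewrite limg_ker_dim.
exists (phi2^-1 \o phi)%VF => x.
rewrite comp_lfunE -[LHS](comp_lfunE phi phi) limg_lfunVK //.
by rewrite img memv_img ?memvf.
Qed.
End Fitting.

(** * Sweedler calculus in a Hopf algebra *)

Section Hopf.
Variables (k : fieldType) (A : hopfAlgType k).
Local Notation Delta := (@comul k A).
Local Notation eps := (@counit k A).
Local Notation S := (@antipode k A).

(** Coassociativity in the form in which it is used: under a trilinear
    expression, splitting the left or the right leg is the same. *)
Lemma comul_assoc (W : vectType k) (T : A -> A -> A -> W) a :
  (forall v w, linear (fun u => T u v w)) -> (forall u w, linear (T u ^~ w)) ->
  (forall u v, linear (T u v)) ->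
  \ten_(x, y <- Delta a) \ten_(u, v <- Delta x) T u v y =
  \ten_(x, y <- Delta a) \ten_(u, v <- Delta y) T x u v.
Proof.
move=> T1 T2 T3.
pose G (t : tens A (tens A A)) := \ten_(x, s <- t) \ten_(u, v <- s) T x u v.
have GL : linear G.
  by rewrite /G; lin; [apply: T1 | apply: T2 | apply: T3].
have := congr1 G (comulA a).
rewrite !(linear_tlift _ _ GL) => E.
have GE x s : G (x \ox s) = \ten_(u, v <- s) T x u v.
  by rewrite /G tlift_pure //; lin; [apply: T1 | apply: T2 | apply: T3].
transitivity (\ten_(x, y <- Delta a) G (\ten_(u, v <- Delta x) u \ox (v \ox y))).
  apply: eq_tlift => x y; rewrite (linear_tlift _ _ GL); apply: eq_tlift => u v.
  by rewrite GE tlift_pure.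
by rewrite E; apply: eq_tlift => x y; rewrite GE.
Qed.

Lemma counitl_lin (W : vectType k) (f : A -> W) a : linear f ->
  \ten_(x, y <- Delta a) eps x *: f y = f a.
Proof.
move=> fL; rewrite -[in RHS](counitl a) (linear_tlift _ _ fL).
by apply: eq_tlift => x y; rewrite (linear_scale _ _ fL).
Qed.

Lemma counitr_lin (W : vectType k) (f : A -> W) a : linear f ->
  \ten_(x, y <- Delta a) eps y *: f x = f a.
Proof.
move=> fL; rewrite -[in RHS](counitr a) (linear_tlift _ _ fL).
by apply: eq_tlift => x y; rewrite (linear_scale _ _ fL).
Qed.

Lemma antipodel_lin (W : vectType k) (f : A -> W) a : linear f ->
  \ten_(x, y <- Delta a) f (S x * y) = eps a *: f 1.
Proof. by move=> fL; rewrite -(linear_tlift _ _ fL) antipodel linear_scale. Qed.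

Lemma antipoder_lin (W : vectType k) (f : A -> W) a : linear f ->
  \ten_(x, y <- Delta a) f (x * S y) = eps a *: f 1.
Proof. by move=> fL; rewrite -(linear_tlift _ _ fL) antipoder linear_scale. Qed.

Lemma comul1_lin (W : vectType k) (b : A -> A -> W) :
  bilinear_map b -> \ten_(x, y <- Delta 1) b x y = b 1 1.
Proof. by move=> bL; rewrite comul1 tlift_pure. Qed.

Lemma comulM_lin (W : vectType k) (T : A -> A -> W) a b : bilinear_map T ->
  \ten_(x, y <- Delta a) \ten_(x', y' <- Delta b) T (x * x') (y * y') =
  \ten_(x, y <- Delta (a * b)) T x y.
Proof.
move=> TL; rewrite comulM /tens_mul.
have L := tlift_linear TL.
rewrite (linear_tlift _ _ L); apply: eq_tlift => x y.
by rewrite (linear_tlift _ _ L); apply: eq_tlift => x' y'; rewrite tlift_pure.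
Qed.

Lemma antipode1 : S 1 = 1.
Proof.
have := antipodel (1 : A); rewrite counit1 scale1r.
by rewrite comul1_lin ?mulr1 //; lin.
Qed.

Lemma counit_antipode a : eps (S a) = eps a.
Proof.
have /(congr1 eps) := antipodel a.
rewrite [RHS]linearZ /= counit1 /GRing.scale /= mulr1 => <-.
rewrite (linear_tlift _ _ (f := eps)); last by move=> c x y; rewrite linearP.
rewrite -[LHS](@counitr_lin k^o (fun x => eps (S x) : k^o)); last by lin.
by apply: eq_tlift => x y; rewrite counitM mulrC.
Qed.

(** Both sides are convolution inverses of the product map from A (x) A to A.  The
    sum of S(a_1 b_1) a_2 b_2 S(b_3) S(a_3) contracts to either of them, according
    to whether the right or the left half is cancelled. *)
Lemma antipodeM (a b : A) : S (a * b) = S b * S a.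
Proof.
transitivity (\ten_(a1, a' <- Delta a) \ten_(a2, a3 <- Delta a')
   \ten_(b1, b' <- Delta b) \ten_(b2, b3 <- Delta b')
     S (a1 * b1) * (a2 * (b2 * S b3) * S a3)).
  (* Cancelling b_2 S(b_3), then a_2 S(a_3), leaves S(a b). *)
  rewrite -[LHS](counitr_lin (f := fun x => S (x * b))); last by lin.
  apply: eq_tlift => a1 a'.
  rewrite -[S (a1 * b)]mulr1 -(antipoder_lin (f := fun z => S (a1 * b) * z));
    last by lin.
  apply: eq_tlift => a2 a3.
  rewrite -(counitr_lin (f := fun z => S (a1 * z) * (a2 * S a3))); last by lin.
  apply: eq_tlift => b1 b'.
  rewrite (antipoder_lin (f := fun z => S (a1 * b1) * (a2 * z * S a3)));
    last by lin.
  by rewrite mulr1.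
(* Cancelling S(a_1 b_1) against a_2 b_2 leaves S(b) S(a). *)
rewrite -comul_assoc; try by lin.
rewrite -[RHS](counitl_lin (f := fun x => S b * S x)); last by lin.
apply: eq_tlift => a' a3.
rewrite -(counitl_lin (f := fun x => S x * S a3)); last by lin.
transitivity (\ten_(a1, a2 <- Delta a') \ten_(b', b3 <- Delta b)
   \ten_(b1, b2 <- Delta b') S (a1 * b1) * (a2 * (b2 * S b3) * S a3)).
  by apply: eq_tlift => a1 a2; rewrite -comul_assoc //; lin.
rewrite exchange_tlift (@scale_tlift k A A A).
apply: eq_tlift => b' b3; rewrite scalerA -counitM.
rewrite -[S b3 * S a3]mul1r.
rewrite -(antipodel_lin (f := fun z => z * (S b3 * S a3))); last by lin.
rewrite -comulM_lin; last by lin.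
by do 2!(apply: eq_tlift => ? ?); rewrite !mulrA.
Qed.

(** * Bijectivity of the antipode *)

(** The composite f o S is the convolution inverse of a multiplicative map f, and
    a convolution inverse determines f.  The product m of the target is arbitrary
    so that antimultiplicative maps are covered as well. *)
Lemma antipode_epi (B : vectType k) (m : B -> B -> B) (u : B) (f g : 'Hom(A, B)) :
    bilinear_map m -> associative m -> left_id u m -> right_id u m ->
    f 1 = u -> g 1 = u ->
    (forall x y, f (x * y) = m (f x) (f y)) ->
    (forall x y, g (x * y) = m (g x) (g y)) ->
    (forall x, f (S x) = g (S x)) -> f =1 g.
Proof.
move=> mL mA um mu f1 g1 fM gM fS a.
(* The convolution of f, f o S = g o S and g equals f or g, as one cancels its
   last or its first two factors. *)
transitivity (\ten_(a1, a' <- Delta a) \ten_(a2, a3 <- Delta a')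
   m (f a1) (m (f (S a2)) (g a3))).
  rewrite -[LHS](counitr_lin (f := f)); last by lin.
  apply: eq_tlift => a1 a'; rewrite -[f a1 in LHS]mu -g1.
  rewrite -(antipodel_lin (f := fun z => m (f a1) (g z))); last by lin.
  by apply: eq_tlift => a2 a3; rewrite gM fS.
rewrite -comul_assoc; try by lin.
rewrite -[RHS](counitl_lin (f := g)); last by lin.
apply: eq_tlift => a' a3; rewrite -[g a3 in RHS]um -f1.
rewrite -(antipoder_lin (f := fun z => m (f z) (g a3))); last by lin.
by apply: eq_tlift => a1 a2; rewrite fM mA.
Qed.

(** The parity of n tells which product S^n respects: that of A or that of the
    opposite algebra. *)
Definition signed_mul (b : bool) (x y : A) := if b then y * x else x * y.

Lemma iter_antipodeM n (x y : A) :
  iter n S (x * y) = signed_mul (odd n) (iter n S x) (iter n S y).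
Proof.
elim: n => //= n ->; rewrite /signed_mul; case: (odd n) => /=; exact: antipodeM.
Qed.

Lemma iter_antipode1 n : iter n S 1 = 1.
Proof. by elim: n => //= n ->; apply: antipode1. Qed.

(** Descent: [antipode_epi] applied to e o S^n and S^n, which are both
    multiplicative or both antimultiplicative, removes one factor S at a time. *)
Lemma antipode_epi_iter (e : 'End(A)) n :
    e 1 = 1 -> (forall x y, e (x * y) = e x * e y) ->
    (forall x, e (iter n S x) = iter n S x) -> e =1 id.
Proof.
move=> e1 eM; elim: n => [//|n IH] eS; apply: IH => x.
suff E : (e \o lfun_iter S n)%VF =1 lfun_iter S n.
  by have := E x; rewrite comp_lfunE !lfun_iterE.
apply: (@antipode_epi A (signed_mul (odd n)) 1).
- by rewrite /signed_mul; case: (odd n); lin.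
- by rewrite /signed_mul => a b c; case: (odd n); rewrite mulrA.
- by rewrite /signed_mul => a; case: (odd n); rewrite ?mul1r ?mulr1.
- by rewrite /signed_mul => a; case: (odd n); rewrite ?mul1r ?mulr1.
- by rewrite comp_lfunE lfun_iterE iter_antipode1.
- by rewrite lfun_iterE iter_antipode1.
- move=> a b; rewrite !comp_lfunE !lfun_iterE iter_antipodeM /signed_mul.
  by case: (odd n); rewrite eM.
- by move=> a b; rewrite !lfun_iterE iter_antipodeM.
- by move=> a; rewrite comp_lfunE !lfun_iterE -!iterSr eS.
Qed.

(** With phi an even power of S, the map e = phi o g of [fitting] is an algebra
    endomorphism fixing the image of phi pointwise, hence the identity; since
    phi(e(a)) = phi(a), equality of S(x) and S(y) propagates to x and y. *)
Lemma lker_antipode : lker S == 0%VS.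
Proof.
have [i [phiI [g phig]]] := fitting S; set phi := lfun_iter _ _ in phiI phig.
have phiM (x y : A) : phi (x * y) = phi x * phi y.
  by rewrite !lfun_iterE iter_antipodeM oddX.
have phi1 : phi 1 = 1 by rewrite lfun_iterE iter_antipode1.
have phi_inj x y : phi (phi x) = phi (phi y) -> phi x = phi y.
  move=> /eqP; rewrite -subr_eq0 -!linearB /= => /eqP/phiI/eqP.
  by rewrite linearB subr_eq0 => /eqP.
have eid : (phi \o g)%VF =1 id.
  apply: (@antipode_epi_iter _ (2 ^ i.+1)%N) => [|x y|x]; rewrite !comp_lfunE /=.
  - by rewrite -[RHS]phi1; apply: phi_inj; rewrite phig !phi1.
  - by rewrite -phiM; apply: phi_inj; rewrite phig !phiM !phig.
  by rewrite -(lfun_iterE S) -/phi; apply: phi_inj; rewrite phig.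
apply/lker0P=> x y Sxy.
have phixy : phi x = phi y.
  by rewrite !lfun_iterE -(prednK (expn_gt0 2 i.+1)) !iterSr Sxy.
by rewrite -[x]eid -[y]eid !comp_lfunE; apply: phi_inj; rewrite !phig.
Qed.

Local Notation Si := (S^-1)%VF.

Lemma antipodeK : cancel S Si.
Proof. exact: lker0_lfunK lker_antipode. Qed.

Lemma antipodeVK : cancel Si S.
Proof. exact: lker0_lfunVK lker_antipode. Qed.

Lemma antipodeV1 : Si 1 = 1.
Proof. by rewrite -[1 in LHS]antipode1 antipodeK. Qed.

Lemma counit_antipodeV a : eps (Si a) = eps a.
Proof. by rewrite -counit_antipode antipodeVK. Qed.

(** The antipode identity for the opposite coproduct, obtained by applying S^-1
    to the one for S. *)
Lemma antipodeVr_lin (W : vectType k) (f : A -> W) a : linear f ->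
  \ten_(x, y <- Delta a) f (y * Si x) = eps a *: f 1.
Proof.
move=> fL; rewrite -[in RHS]antipodeV1.
rewrite -(antipoder_lin (f := fun z => f (Si z))); last first.
  by move=> c x y; rewrite linearP fL.
apply: eq_tlift => x y; congr f; rewrite -[LHS]antipodeK; congr (Si _).
by rewrite antipodeM antipodeVK.
Qed.
End Hopf.

(** * Products in the Drinfel'd double and the map Q *)

Section Double.
Variables (k : fieldType) (A : hopfAlgType k).
Local Notation Delta := (@comul k A).
Local Notation eps := (@counit k A).
Local Notation S := (@antipode k A).
Local Notation Si := (S^-1)%VF.
Local Notation D := (drinfeld_double A).
Implicit Types (a b : A) (p q f : dual A).

Lemma lact1 p : lact 1 p = p.
Proof. by apply/lfunP=> a; rewrite lactE mulr1. Qed.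

Lemma ract1 p : ract p 1 = p.
Proof. by apply/lfunP=> a; rewrite ractE mul1r. Qed.

Lemma lactM a b p : lact a (lact b p) = lact (a * b) p.
Proof. by apply/lfunP=> c; rewrite !lactE mulrA. Qed.

Lemma ractM a b p : ract (ract p a) b = ract p (a * b).
Proof. by apply/lfunP=> c; rewrite !ractE mulrA. Qed.

Lemma lact_ract a b p : lact a (ract p b) = ract (lact a p) b.
Proof. by apply/lfunP=> c; rewrite !(lactE, ractE) mulrA. Qed.

Lemma lact_counit a : lact a eps = eps a *: eps.
Proof.
by apply/lfunP=> b; rewrite lactE counitM scale_lfunE /GRing.scale /= mulrC.
Qed.

Lemma conv1p p : conv eps p = p.
Proof.
apply/lfunP=> a; rewrite convE -(@counitl_lin _ _ k^o p) //.
exact: linearP.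
Qed.

Lemma convp1 p : conv p eps = p.
Proof.
apply/lfunP=> a; rewrite convE -(@counitr_lin _ _ k^o p); last exact: linearP.
by apply: eq_tlift => x y; rewrite [LHS]mulrC.
Qed.

Lemma drinfeld_mul_pure p a q b :
  drinfeld_mul (p \ox a : D) (q \ox b : D) =
  \ten_(a1, a23 <- Delta a) \ten_(a2, a3 <- Delta a23)
    (conv p (ract (lact a1 q) (Si a3)) \ox (a2 * b)).
Proof. by rewrite /drinfeld_mul !tlift_pure //; lin. Qed.

Lemma drinfeld_mul_bilinear : bilinear_map (@drinfeld_mul k A).
Proof. by rewrite /drinfeld_mul; lin. Qed.

Lemma drinfeld_mul_dual_alg p b :
  drinfeld_mul (p \ox 1 : D) (eps \ox b : D) = p \ox b.
Proof.
rewrite drinfeld_mul_pure !comul1_lin; try by lin.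
by rewrite lact1 antipodeV1 ract1 convp1 mul1r.
Qed.

Lemma drinfeld_mul_1dual q :
  drinfeld_mul (eps \ox 1 : D) (q \ox 1 : D) = q \ox 1.
Proof.
rewrite drinfeld_mul_pure !comul1_lin; try by lin.
by rewrite lact1 antipodeV1 ract1 conv1p mul1r.
Qed.

Lemma drinfeld_mul_alg1 a :
  drinfeld_mul (eps \ox a : D) (eps \ox 1 : D) = eps \ox a.
Proof.
rewrite drinfeld_mul_pure.
rewrite -[RHS](counitl_lin (f := fun z => eps \ox z)); last by lin.
apply: eq_tlift => a1 a23.
rewrite -(counitr_lin (f := fun z => eps a1 *: (eps \ox z))); last by lin.
apply: eq_tlift => a2 a3; rewrite conv1p mulr1 lact_counit.
have [pl pr] := @pure_bilinear k (dual A) A.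
have -> : ract (eps a1 *: eps : dual A) (Si a3) = (eps a3 * eps a1) *: (eps : dual A).
  apply/lfunP=> b; rewrite ractE !scale_lfunE counitM counit_antipodeV.
  by rewrite /GRing.scale /= mulrCA mulrA.
by rewrite (linear_scale _ _ (pl a2)) scalerA.
Qed.

(** Straightening.  The product expands to a sum over five legs of a,
    (a_2 S^-1(a_1)) -> f <- (a_5 S^-1(a_4)) (x) a_3.  The pair (a_4, a_5) is
    contracted first, then (a_1, a_2). *)
Lemma drinfeld_mul_cross a f :
  \ten_(x, y <- Delta a) \ten_(z, w <- Delta y)
    drinfeld_mul (eps \ox z : D) (ract (lact (Si x) f) w \ox 1 : D) = f \ox a.
Proof.
pose T u s w : D := ract (lact u f) w \ox s.
have TE (z x w : A) : drinfeld_mul (eps \ox z : D) (ract (lact (Si x) f) w \ox 1 : D) =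
   \ten_(u, v <- Delta z) \ten_(s, t <- Delta v) T (u * Si x) s (w * Si t).
  rewrite drinfeld_mul_pure; do 2!apply: eq_tlift => ? ?.
  by rewrite conv1p mulr1 lact_ract lactM ractM.
rewrite (_ : f \ox a = T 1 a 1); last by rewrite /T lact1 ract1.
transitivity (\ten_(x, y <- Delta a) \ten_(u, y' <- Delta y) T (u * Si x) y' 1).
  apply: eq_tlift => x y.
  transitivity (\ten_(z, w <- Delta y) \ten_(u, v <- Delta z)
     \ten_(s, t <- Delta v) T (u * Si x) s (w * Si t)).
    by apply: eq_tlift => z w; rewrite TE.
  rewrite comul_assoc; try by rewrite /T; lin.
  apply: eq_tlift => u y'; rewrite comul_assoc; try by rewrite /T; lin.
  rewrite -[RHS](counitr_lin (f := fun s => T (u * Si x) s 1)); last by rewrite /T; lin.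
  apply: eq_tlift => s y''.
  by rewrite (antipodeVr_lin (f := T (u * Si x) s)) // /T; lin.
rewrite -comul_assoc; try by rewrite /T; lin.
rewrite -(counitl_lin (f := fun s => T 1 s 1)); last by rewrite /T; lin.
apply: eq_tlift => s y.
by rewrite (antipodeVr_lin (f := fun z => T z y 1)) // /T; lin.
Qed.

Section Basis.
Variables (n : nat) (e : n.-tuple A) (he : basis_of {:A} e).

Lemma dual_basis_expand f : f = \sum_(i < n) f e`_i *: dual_basis e i.
Proof.
apply/lfunP=> a; rewrite sum_lfunE {1}(coord_basis he (memvf a)) linear_sum.
by apply: eq_bigr => i _; rewrite linearZ scale_lfunE dual_basisE /GRing.scale /= mulrC.
Qed.

(** The scalar P(R^2 r^1) is the value of a (x) f at e^i (x) e_j, that is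
    e^i(a) f(e_j); these are the coordinates of a and f, and summing over i and j
    puts a and f in place of e_i and e^j. *)
Lemma Qmap_heisenberg a f :
  Qmap e (heisenberg_dual A (a \ox f : heisenberg A)) =
  drinfeld_mul (eps \ox a : D) (f \ox 1 : D).
Proof.
have mL := drinfeld_mul_bilinear.
rewrite QmapE /Rmatrix tlift_sum; last by lin.
rewrite [in RHS](coord_basis he (memvf a)).
rewrite (linear_sumZ (f := fun z : A => drinfeld_mul (eps \ox z : D) (f \ox 1 : D)));
  last by lin.
apply: eq_bigr => i _; rewrite tlift_pure; last by lin.
rewrite tlift_sum; last by lin.
rewrite [in RHS](dual_basis_expand f).
rewrite (linear_sumZ (f := fun z : dual A =>
  drinfeld_mul (eps \ox e`_i : D) (z \ox 1 : D))); last by lin.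
rewrite scaler_sumr; apply: eq_bigr => j _; rewrite tlift_pure; last by lin.
by rewrite drinfeld_mul_dual_alg heisenberg_dualE dual_basisE scalerA.
Qed.

Lemma Qmap_bij : bijective (Qmap e).
Proof.
have imQ : limg (Qmap e) = fullv.
  apply/eqP; rewrite eqEsubv subvf; apply/subvP=> x _.
  rewrite -(tlift_id x); apply: memv_suml => i _; rewrite -drinfeld_mul_cross.
  do 2!apply: memv_suml => ? _; rewrite -Qmap_heisenberg.
  by apply: memv_img; rewrite memvf.
have kerQ : lker (Qmap e) == 0%VS.
  have dimD : dim (dual D) = dim D by apply: muln1.
  have := limg_ker_dim (Qmap e) fullv.
  rewrite capfv imQ !dimvf dimD => /eqP.
  by rewrite -[X in _ == X]add0n eqn_add2r dimv_eq0.
exists (Qmap e)^-1%VF; first exact: lker0_lfunK.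
by move=> x; rewrite limg_lfunVK // imQ memvf.
Qed.

End Basis.
End Double.

Theorem proposition4p12 (k : fieldType) (A : hopfAlgType k)
    (n : nat) (e : n.-tuple A) (he : basis_of {:A} e) :
  bijective (Qmap e) /\
  tmap (heisenberg_dual A) (heisenberg_dual A) (Wcan e) =
  tmap (Qmap e)^-1%VF (Qmap e)^-1%VF (tflip (Rmatrix e)).
Proof.
have Qbij := Qmap_bij he; split=> //.
have QK : cancel (Qmap e) (Qmap e)^-1%VF.
  apply: lker0_lfunK; apply/lker0P; exact: bij_inj.
have flipR : tflip (Rmatrix e) = \sum_(i < n)
    (dual_basis e i \ox 1 : drinfeld_double A) \ox
    (counit \ox e`_i : drinfeld_double A).
  rewrite /tflip tlift_sum; last by lin.
  by apply: eq_bigr => i _; rewrite tlift_pure //; lin.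
rewrite flipR /tmap !tlift_sum; try by lin.
apply: eq_bigr => i _; rewrite !tlift_pure; try by lin.
congr (_ \ox _).
  by rewrite -[LHS]QK Qmap_heisenberg // drinfeld_mul_1dual.
by rewrite -[LHS]QK Qmap_heisenberg // drinfeld_mul_alg1.
Qed.
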